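(* The generating functions of the numbers of brick-wall lattice paths of the first and second type for rectangles of width $w=4$ are, as formal power series, $$\sum_{l=1}^{\infty}\mathcal B^{(1)}_{l,4}\,z^l=\frac{4z+6z^2}{1-3z^2},\qquad \sum_{l=1}^{\infty}\mathcal B^{(2)}_{l,4}\,z^l=\frac{4z+8z^2}{1-3z^2}.$$
   Context: A point $(a,b)\in\mathbf Z\times\mathbf Z$ is even (odd) if $|a|+|b|$ is even (odd). A brick-wall lattice path of the first type is a finite sequence of points of $\mathbf Z\times\mathbf Z$ in which each consecutive step is either the horizontal step $(1,0)$ (allowed from any point), or the step $(0,1)$ taken from an even point, or the step $(0,-1)$ taken from an odd point. A brick-wall lattice path of the second type is defined in the same way with the steps $(1,0)$ from any point, $(0,1)$ from an odd point, $(0,-1)$ from an even point. Paths visit no point more than once; the empty path (a single point) is allowed. Let $\mathcal R=[0,l-1]\times[0,w-1]$, here with $w=4$. For $t\in\{1,2\}$, $\mathcal B^{(t)}_{l,w}$ is the number of brick-wall lattice paths of type $t$ (type 1 = first, type 2 = second) starting at some point $(0,\alpha)$ and ending at some point $(l-1,\beta)$, with $\alpha,\beta\in\{0,\dots,w-1\}$, staying inside $\mathcal R$ and using no vertical step along the left side $x=0$ (vertical steps along the right side $x=l-1$ are allowed when $l\ge2$). For $l=1$ the rectangle is a degenerate vertical segment and only the $w$ empty paths are counted. *)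

(* Defs.v *)
From mathcomp Require Import all_boot all_order all_algebra.

Set Implicit Arguments.
Unset Strict Implicit.
Unset Printing Implicit Defensive.

Import Order.TTheory GRing.Theory Num.Theory.
Local Open Scope ring_scope.

Definition point : Type := (int * int)%type.

Definition even_point (p : point) : bool := ~~ odd (`|p.1| + `|p.2|)%N.
Definition odd_point (p : point) : bool := odd (`|p.1| + `|p.2|)%N.

Inductive bw_type : Type := First | Second.

Definition bw_step (t : bw_type) (p q : point) : bool :=
  match t with
  | First => [|| q == (p.1 + 1, p.2),
                 even_point p && (q == (p.1, p.2 + 1))
               | odd_point p && (q == (p.1, p.2 - 1))]
  | Second => [|| q == (p.1 + 1, p.2),
                  odd_point p && (q == (p.1, p.2 + 1))
                | even_point p && (q == (p.1, p.2 - 1))]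
  end.

(* A path is the nonempty sequence of the points it visits; the empty path at
   [x] is the one-point sequence [[:: x]]. *)
Definition bw_path (t : bw_type) (p : seq point) : bool :=
  if p is x :: s then path (bw_step t) x s && uniq p else false.

Definition in_rect (l w : nat) (p : point) : bool :=
  (0 <= p.1 <= l%:Z - 1) && (0 <= p.2 <= w%:Z - 1).

(* A step between two points with [x = 0] is vertical. *)
Definition left_vertical (p q : point) : bool := (p.1 == 0) && (q.1 == 0).

(* For [l = 1] the right side is the left side, so no vertical step survives and
   only the [w] empty paths are crossings. *)
Definition bw_crossing (t : bw_type) (l w : nat) (p : seq point) : bool :=
  [&& bw_path t p,
      [exists a : 'I_w, head (0, 0) p == (0, (a : nat)%:Z)],
      [exists b : 'I_w, last (0, 0) p == (l%:Z - 1, (b : nat)%:Z)],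
      all (in_rect l w) p
    & sorted (fun u v => ~~ left_vertical u v) p].

Definition rect_point (l w : nat) (u : 'I_l * 'I_w) : point :=
  ((u.1 : nat)%:Z, (u.2 : nat)%:Z).

(* A self-avoiding path inside the rectangle has at most [l * w] points, so
   ranging over sequences of bounded length loses nothing: [bw_countP] below
   shows that this is the number of all [p] with [bw_crossing t l w p]. *)
Definition bw_count (t : bw_type) (l w : nat) : nat :=
  #|[set s : {bseq (l * w) of 'I_l * 'I_w}
      | bw_crossing t l w (map (@rect_point l w) s)]|.

Lemma rect_point_inj l w : injective (@rect_point l w).
Proof.
by move=> [a b] [c d] [ac bd]; congr pair; apply: val_inj.
Qed.

Lemma in_rectP l w (p : point) :
  in_rect l w p -> exists u, @rect_point l w u = p.
Proof.
case: p => a b; rewrite /in_rect /= => /andP[/andP[a0 al] /andP[b0 bw]].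
case: a a0 al => // a _ al; case: b b0 bw => // b _ bw.
have al' : (a < l)%N by rewrite -ltz_nat -lezD1 -lerBrDr.
have bw' : (b < w)%N by rewrite -ltz_nat -lezD1 -lerBrDr.
by exists (Ordinal al', Ordinal bw').
Qed.

Lemma bw_countP t l w : exists e : seq (seq point),
  [/\ uniq e, forall p, (p \in e) = bw_crossing t l w p
    & size e = bw_count t l w].
Proof.
pose A := [set s : {bseq (l * w) of 'I_l * 'I_w}
            | bw_crossing t l w (map (@rect_point l w) s)].
exists [seq map (@rect_point l w) (bseqval s) | s <- enum A]; split.
- rewrite map_inj_uniq ?enum_uniq // => s s' ss'.
  by apply: val_inj; apply: inj_map ss'; apply: rect_point_inj.
- move=> p; apply/mapP/idP => [[s]|cp].
    by rewrite mem_enum inE => cs ->.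
  have [s sp] : exists s, map (@rect_point l w) s = p.
    case/and5P: cp => _ _ _ + _; elim: p => [_|x p IHp /= /andP[xr pr]].
      by exists [::].
    have [s <-] := IHp pr; have [u <-] := in_rectP xr.
    by exists (u :: s).
  have us : uniq s.
    rewrite -(map_inj_uniq (@rect_point_inj l w)) sp.
    by case/and5P: cp; case: (p) => // x q /andP[].
  have ss : (size s <= l * w)%N.
    have := max_card [in s]; rewrite card_prod !card_ord.
    by have /card_uniqP -> := us.
  exists (Bseq ss); last by rewrite /= sp.
  by rewrite mem_enum inE /= sp.
- by rewrite size_map -cardE.
Qed.

Definition fps (R : Type) : Type := nat -> R.

Definition fps_of_poly (R : nzRingType) (p : {poly R}) : fps R := fun n => p`_n.

Definition fps_mul (R : nzRingType) (f g : fps R) : fps R :=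
  fun n => \sum_(i < n.+1) f i * g (n - i)%N.

(* [fps_inv_seq f n] lists the first [n] coefficients [g 0, g 1, ...] of [1/f],
   solving [\sum_(i <= m) f (m - i) * g i = (m == 0)] for [g m]. *)
Fixpoint fps_inv_seq (R : unitRingType) (f : fps R) (n : nat) : seq R :=
  if n is m.+1 then
    let s := fps_inv_seq f m in
    rcons s ((f 0%N)^-1 * ((m == 0%N)%:R - \sum_(i < m) f (m - i)%N * s`_i))
  else [::].

Definition fps_inv (R : unitRingType) (f : fps R) : fps R :=
  fun n => (fps_inv_seq f n.+1)`_n.

Definition fps_div (R : unitRingType) (f g : fps R) : fps R :=
  fps_mul f (fps_inv g).

Lemma size_fps_inv_seq (R : unitRingType) (f : fps R) n :
  size (fps_inv_seq f n) = n.
Proof. by elim: n => //= n IHn; rewrite size_rcons IHn. Qed.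

Lemma nth_fps_inv_seq (R : unitRingType) (f : fps R) n i :
  (i < n)%N -> (fps_inv_seq f n)`_i = fps_inv f i.
Proof.
elim: n => // n IHn; rewrite ltnS leq_eqVlt => /orP[/eqP->//|lt_in].
by rewrite /= nth_rcons size_fps_inv_seq lt_in IHn.
Qed.

(* So [fps_div f g] is the quotient [f / g] whenever [g 0] is a unit. *)
Lemma fps_mulV (R : comUnitRingType) (f : fps R) :
  f 0%N \is a GRing.unit -> fps_mul f (fps_inv f) =1 fps_of_poly 1.
Proof.
move=> f0 n; rewrite /fps_mul /fps_of_poly coef1.
rewrite big_ord_recl subn0 {1}/fps_inv /= nth_rcons size_fps_inv_seq.
rewrite ltnn eqxx mulVKr //.
rewrite [X in _ - X + _](_ : _ = \sum_(i < n) f (bump 0 i) * fps_inv f (n - bump 0 i)%N).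
  by rewrite subrK.
rewrite (reindex_inj rev_ord_inj) /=; apply: eq_bigr => i _.
rewrite nth_fps_inv_seq; last by rewrite ltn_subrL /= (leq_ltn_trans _ (ltn_ord i)).
by rewrite /bump /= add1n subKn.
Qed.

Definition bw_series (t : bw_type) (w : nat) : fps rat :=
  fun l => if (0 < l)%N then (bw_count t l w)%:R else 0.

(* Main.v *)
(* A vertical step can only be followed by a horizontal step or by its own
   reversal, so a self-avoiding crossing makes at most one vertical step per
   column.  The numbers (a, b, c, d) of crossings by final height therefore
   evolve linearly: from one column to the next they become alternately
   (a + b, a + b, c + d, c + d) and (a, b + c, b + c, d).  Two consecutive
   steps triple the total, since a + d = b + c holds for the initial vector
   (1, 1, 1, 1) and after each step of the first kind. *)

Require Import Defs.
From mathcomp Require Import all_boot all_order all_algebra.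
From mathcomp Require Import zify ring.

Import Order.TTheory GRing.Theory.
Local Open Scope ring_scope.

(** * Coefficients of a quadratic numerator divided by [1 - 3 z^2] *)

Lemma fps_mul_deg2 (R : nzRingType) (p : {poly R}) (g : fps R) n :
  (size p <= 3)%N ->
  fps_mul (fps_of_poly p) g n.+2 = p`_0 * g n.+2 + p`_1 * g n.+1 + p`_2 * g n.
Proof.
move=> sp; rewrite /fps_mul !big_ord_recl /= big1 ?addr0.
  by rewrite /bump /= !addrA subn0 !subSS !subn0.
move=> i _; rewrite /fps_of_poly nth_default ?mul0r //.
by rewrite (leq_trans sp) // /bump /=; lia.
Qed.

Section Quotient.

Variable c : rat.
Let num : {poly rat} := 4 *: 'X + c *: 'X^2.
Let den : {poly rat} := 1 - 3 *: 'X^2.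
Let h : fps rat := fps_div (fps_of_poly num) (fps_of_poly den).
Let g : fps rat := fps_inv (fps_of_poly den).

Let size_num : (size num <= 3)%N.
Proof.
apply/leq_sizeP => j j3; rewrite !coefE; case: j j3 => [|[|[|j]]] //=.
by rewrite !mulr0 addr0.
Qed.

Let size_den : (size den <= 3)%N.
Proof.
by apply/leq_sizeP => j j3; rewrite !coefE; case: j j3 => [|[|[|j]]] //=.
Qed.

Let den0 : fps_of_poly den 0%N = 1.
Proof. by rewrite /fps_of_poly !coefE /= mulr0 subr0. Qed.

Let denV := fps_mulV (f := fps_of_poly den).

Let g0 : g 0%N = 1.
Proof.
have := denV _ 0%N; rewrite den0 unitr1 => /(_ isT).
by rewrite /fps_mul big_ord_recl big_ord0 addr0 den0 mul1r /fps_of_poly coef1.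
Qed.

Let g1 : g 1%N = 0.
Proof.
have := denV _ 1%N; rewrite den0 unitr1 => /(_ isT).
rewrite /fps_mul !big_ord_recl big_ord0 addr0 den0 mul1r /fps_of_poly !coefE /=.
by rewrite mulr0 subr0 mul0r addr0.
Qed.

Let gSS n : g n.+2 = 3 * g n.
Proof.
have := denV _ n.+2; rewrite den0 unitr1 => /(_ isT).
rewrite fps_mul_deg2 // -/g /fps_of_poly !coefE /= => E.
by apply/subr0_eq; apply: etrans E; ring.
Qed.

(** Since [h] is the product of [num] and [g], it inherits the recurrence of [g] once the numerator
    stops contributing. Its last contribution is [c] at index 2, so the recurrence starts at index
    3. *)
Lemma fps_quot_rec :
  [/\ h 0%N = 0, h 1%N = 4, h 2%N = c & forall n, h n.+3 = 3 * h n.+1].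
Proof.
have hSS n : h n.+2 = 4 * g n.+1 + c * g n.
  by rewrite /h /fps_div fps_mul_deg2 // -/g !coefE /=; ring.
have h1 : h 1%N = 4.
  rewrite /h /fps_div /fps_mul !big_ord_recl big_ord0 -/g /fps_of_poly !coefE /= g0.
  by rewrite g1; ring.
split=> // [||n].
- by rewrite /h /fps_div /fps_mul big_ord_recl big_ord0 /fps_of_poly !coefE /=; ring.
- by rewrite hSS g1 g0; ring.
case: n => [|n]; last by rewrite !hSS !gSS; ring.
by rewrite h1 hSS gSS g0 g1; ring.
Qed.

Lemma fps_quot_unique (f : fps rat) :
  f 0%N = 0 -> f 1%N = 4 -> f 2%N = c -> (forall n, f n.+3 = 3 * f n.+1) ->
  f =1 h.
Proof.
have [h0 h1 h2 hr] := fps_quot_rec => f0 f1 f2 fr n.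
(* The recurrence reaches back two indices, so the induction carries two consecutive
   coefficients. *)
suff H m : f m.+1 = h m.+1 /\ f m.+2 = h m.+2.
  by case: n => [|n]; [rewrite f0 h0 | case: (H n)].
by elim: m => [|m [IH1 IH2]]; rewrite ?f1 ?f2 ?h1 ?h2 // IH2 fr hr IH1.
Qed.

End Quotient.

(** * Enumeration of the crossings column by column, for any width *)

Section Crossings.

Variables (t : bw_type) (w : nat).

Definition lattice_pt (x y : nat) : point := (x%:Z, y%:Z).

(* The crossings of [0, n] x [0, w - 1] that end at height [y], each listed
   from its end so that a new column is added at the head. *)
Fixpoint rev_crossings (n y : nat) : seq (seq point) :=
  if n is m.+1 then
    [seq lattice_pt n y :: p | p <- rev_crossings m y] ++
    [seq lattice_pt n y :: lattice_pt n z :: p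
      | z <- [seq z <- iota 0 w | bw_step t (lattice_pt n z) (lattice_pt n y)],
        p <- rev_crossings m z]
  else [:: [:: lattice_pt 0 y]].

Definition rev_step (u v : point) : bool := bw_step t v u && ~~ left_vertical v u.

Definition in_strip (u : point) : bool := 0 <= u.2 <= w%:Z - 1.

(* A crossing listed from its end, with the abscissae not yet bounded: those
   bounds follow since steps never decrease the abscissa. *)
Definition rev_crossing (p : seq point) : bool :=
  if p is a :: s then
    [&& path rev_step a s, uniq p, all in_strip p & (last a s).1 == 0]
  else false.

Arguments rev_crossing : simpl never.

Lemma rev_crossing_cons a b s :
  rev_crossing [:: a, b & s] =
  [&& rev_step a b, a \notin b :: s, in_strip a & rev_crossing (b :: s)].
Proof.
rewrite /rev_crossing [uniq (a :: _)]cons_uniq [all _ (a :: _)]/= [path _ a _]/= [last a _]/=.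
rewrite -!andbA; do !bool_congr.
Qed.

(** A vertical step changes the parity of the point, and at the new parity the only vertical step
    allowed has the opposite direction. *)
Lemma bw_stepP u v : bw_step t u v ->
  v = (u.1 + 1, u.2) \/ [/\ v.1 = u.1, v.2 != u.2 &
    forall x, bw_step t v x -> x = (v.1 + 1, v.2) \/ x = u].
Proof.
case: u v => a b [c d]; rewrite /bw_step /even_point /odd_point.
case: t => /=; (case/or3P; [by move=> /eqP ->; left | |]);
  move=> /andP[o /eqP[-> ->]]; right; split=> //=; try lia;
  move=> [e f] /or3P[/eqP ->|/andP[o' /eqP[-> ->]]|/andP[o' /eqP[-> ->]]];
  try (by left); right; try (congr pair); lia.
Qed.

Lemma rev_crossing_abscissa a s : rev_crossing (a :: s) ->
  all (fun u : point => 0 <= u.1 <= a.1) (a :: s).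
Proof.
elim: s a => [|b s IHs] a; first by move=> /and4P[_ _ _ /= /eqP ->].
rewrite rev_crossing_cons => /and4P[/andP[st _] _ _ /IHs bs].
have ba : b.1 <= a.1 by case: (bw_stepP _ _ st) => [->|[-> _ _]] /=; lia.
have : all (fun u : point => 0 <= u.1 <= a.1) (b :: s).
  by apply: sub_all bs => u /andP[-> /= ub]; apply: le_trans ba.
by rewrite /= => /andP[/andP[b0 b1] ->]; rewrite b0 b1 !andbT; lia.
Qed.

Lemma rev_crossings_sound n y p : (y < w)%N -> p \in rev_crossings n y ->
  rev_crossing p && (head (0, 0) p == lattice_pt n y).
Proof.
have strip m z : (z < w)%N -> in_strip (lattice_pt m z) by rewrite /in_strip /=; lia.
elim: n y p => [|n IHn] y p yw.
  by rewrite inE => /eqP ->; rewrite /rev_crossing /= strip // !eqxx.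
(* Entering column [n.+1] horizontally cannot break self-avoidance: all earlier points have abscissa
   at most [n]. *)
have horiz z q : (z < w)%N -> q \in rev_crossings n z ->
    rev_crossing (lattice_pt n.+1 z :: q) /\
    all (fun u : point => u.1 <= n%:Z) q.
  move=> zw /(IHn _ _ zw); case: q => // b q /andP[cq /eqP /= qh].
  have le_n : all (fun u : point => u.1 <= n%:Z) (b :: q).
    by apply: sub_all (rev_crossing_abscissa _ _ cq) => u; rewrite qh => /andP[].
  split=> //; rewrite rev_crossing_cons cq strip // !andbT; apply/andP; split.
    rewrite qh /rev_step /left_vertical /= andbF andbT.
    have E : lattice_pt n.+1 z = ((lattice_pt n z).1 + 1, (lattice_pt n z).2).
      by congr pair => /=; lia.
    by rewrite E /bw_step; case: t; rewrite eqxx.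
  by apply/negP => /(allP le_n) /=; lia.
rewrite mem_cat => /orP[/mapP[q qn ->]|/allpairsPdep[z [q [+ qn ->]]]].
  by have [-> _] := horiz _ _ yw qn; rewrite eqxx.
rewrite mem_filter mem_iota /= add0n => /andP[st zw].
have [cq qle] := horiz _ _ zw qn.
rewrite eqxx andbT rev_crossing_cons cq strip // /rev_step st.
rewrite /left_vertical /= !andbT inE negb_or; apply/andP; split; last first.
  by apply/negP => /(allP qle) /=; lia.
apply/negP => /eqP E; have := bw_stepP _ _ st; rewrite E /= => -[[]|[_ /eqP]] //.
by lia.
Qed.

(** The final step is either horizontal, or vertical and preceded by a horizontal one; these are the
    two lists joined in [rev_crossings]. The induction is on a length bound because the second case
    removes two points. *)
Lemma rev_crossings_complete p n y : rev_crossing p ->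
  head (0, 0) p = lattice_pt n y -> p \in rev_crossings n y.
Proof.
have [k] := ubnP (size p); elim: k p n y => // k IHk [|a [|b s]] // n y.
  by move=> _ /and4P[_ _ _ /= /eqP a0] /= E; move: a0; rewrite E /= => -[->]; rewrite inE.
rewrite ltnS => sk cp /= E; move: (cp); rewrite rev_crossing_cons E.
move=> /and4P[/andP[st nl] ab _ cb].
have ge0 c r : rev_crossing (c :: r) -> exists m z, c = lattice_pt m z.
  move=> cr; have /andP[c0 _] := rev_crossing_abscissa _ _ cr.
  have : in_strip c by case/and4P: cr => _ _ /andP[].
  case: c c0 {cr} => -[c|c] [d|d] //=; rewrite /in_strip /=; try lia.
  by move=> _ _; exists c, d.
have [m [z bE]] := ge0 _ _ cb.
have step_case := bw_stepP _ _ st.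
case: step_case; rewrite {1 2}bE /lattice_pt /=.
  move=> [nm yz]; have -> : n = m.+1 by lia.
  rewrite mem_cat /= map_f //; apply: IHk => //.
  by rewrite bE; congr pair; lia.
move=> [nm zy _]; have {nm} nm : n = m by lia.
(* If nothing precedes the vertical step, it lies on the left side, where it is forbidden. *)
subst m; case: s sk cp ab cb => [|c s] sk cp ab cb.
  case/and4P: cb => _ _ _ /= b0.
  by move: nl; rewrite /left_vertical b0 /=; move: b0; rewrite bE /= => ->.
move: (cb); rewrite rev_crossing_cons => /and4P[/andP[st' _] _ _ cc].
have [m [u cE]] := ge0 _ _ cc.
(* After a vertical step from [c] to [b], the vertical step to [a] would return to [c], against
   uniqueness. *)
case: (bw_stepP _ _ st') => [bc|[_ _ /(_ _ st)]]; last first.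
  case=> [|ac]; last by rewrite ac !inE eqxx orbT in ab.
  by rewrite bE /lattice_pt /= => -[]; lia.
move: bc; rewrite bE cE /lattice_pt /= => -[nm zu].
have -> : n = m.+1 by lia.
have -> : z = u by lia.
rewrite mem_cat; apply/orP; right; apply/allpairsPdep; exists u, (c :: s); split.
- rewrite mem_filter mem_iota /= add0n.
  have /andP[cs _] : all in_strip (c :: s) by case/and4P: cc.
  move: cs; rewrite cE /in_strip /= => cs; apply/andP; split; last by lia.
  move: st; rewrite bE; congr (bw_step t _ _); congr pair; lia.
- by apply: IHk => //=; move: sk => /=; lia.
- by rewrite cE.
Qed.

Lemma bw_crossing_rev n p : bw_crossing t n.+1 w (rev p) =
  rev_crossing p && [exists y : 'I_w, head (0, 0) p == lattice_pt n y].
Proof.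
case: p => [|a s]; first by [].
have lastE : last (0, 0) (rev (a :: s)) = a by rewrite rev_cons last_rcons.
have headE : head (0, 0) (rev (a :: s)) = last a s.
  by rewrite (lastI a s) rev_rcons.
have pathE : bw_path t (rev (a :: s)) =
    sorted (bw_step t) (rev (a :: s)) && uniq (a :: s).
  rewrite -(rev_uniq (a :: s)); case: (rev (a :: s)) (size_rev (a :: s)) => //.
rewrite /bw_crossing pathE headE lastE all_rev !rev_sorted.
have -> : (n.+1%:Z - 1 = n%:Z) by lia.
apply/idP/idP.
  case/and5P=> /andP[sp up] /existsP[i /eqP i0] -> ar sl; rewrite andbT.
  rewrite /rev_crossing up i0 eqxx andbT /=; apply/andP; split.
    rewrite /rev_step; elim: (s) (a) sp sl => //= b r IHr c /andP[-> +] /andP[-> +].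
    exact: IHr.
  by apply: sub_all ar => u /andP[].
case/andP=> cp ex; rewrite ex; have xs := rev_crossing_abscissa _ _ cp.
case/existsP: (ex) => y /eqP aE; case/and4P: cp => ps us hs l0.
rewrite us andbT andTb; apply/and4P; split.
- by apply: sub_path ps => u v /andP[].
- have ls : in_strip (last a s) by apply: (allP hs); rewrite mem_last.
  case: (last a s) ls l0 => c [d|d]; rewrite /in_strip /=; last by lia.
  move=> dw /eqP ->; have dlt : (d < w)%N by lia.
  by apply/existsP; exists (Ordinal dlt).
- apply/allP => u ua; rewrite /in_rect; have := allP hs u ua; have := allP xs u ua.
  rewrite -[a]/(head (0, 0) (a :: s)) aE /in_strip /= => h1 h2; apply/andP; split=> //; lia.
- by apply: sub_path ps => u v /andP[].
Qed.

(** The two lists joined in [rev_crossings] are disjoint: the second point of a member has abscissa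
    [n] in one and [n.+1] in the other. *)
Lemma rev_crossings_uniq n y : (y < w)%N -> uniq (rev_crossings n y).
Proof.
have headE := rev_crossings_sound.
elim: n y => // n IHn y yw; rewrite /= cat_uniq; apply/and3P; split.
- by rewrite map_inj_uniq ?IHn // => p q [].
- apply/hasPn => r /allpairsPdep[z [q [_ _ ->]]]; apply/negP => /mapP[p pn [pE]].
  have /andP[_] := headE _ _ _ yw pn.
  by rewrite -pE /= => /eqP[]; lia.
- apply: allpairs_uniq_dep => [|z|].
  + by rewrite filter_uniq // iota_uniq.
  + by rewrite mem_filter mem_iota => /andP[_ /andP[_ zw]]; apply: IHn.
  by move=> [z p] [z' p'] _ _ /= [-> ->].
Qed.

(** Up to reversal, both sides count the members of duplicate-free lists with the same elements; the
    first point of a reversed crossing determines its final height, so different heights share no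
    crossing. *)
Lemma bw_count_rev_crossings n :
  bw_count t n.+1 w = sumn [seq size (rev_crossings n y) | y <- iota 0 w].
Proof.
have [e [eu em <-]] := bw_countP t n.+1 w.
rewrite -(size_allpairs_dep (fun _ => rev)); apply/perm_size/uniq_perm => //.
  apply: allpairs_uniq_dep; first exact: iota_uniq.
    by move=> y; rewrite mem_iota => /andP[_ yw]; apply: rev_crossings_uniq.
  move=> _ _ /allpairsPdep[y [p [+ pn ->]]] /allpairsPdep[z [q [+ qn ->]]] /=
    /(can_inj revK) pq.
  rewrite !mem_iota => /andP[_ yw] /andP[_ zw]; subst q.
  have /andP[_ /eqP yE] := rev_crossings_sound _ _ _ yw pn.
  have /andP[_ /eqP zE] := rev_crossings_sound _ _ _ zw qn.
  by move: zE; rewrite yE => -[->].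
move=> p; rewrite em -[p]revK bw_crossing_rev.
apply/andP/allpairsPdep => [[cp /existsP[y /eqP yE]]|[y [q [+ qn /(can_inj revK) ->]]]].
  exists (nat_of_ord y), (rev p); split; rewrite ?revK ?mem_iota ?ltn_ord //.
  exact: rev_crossings_complete.
rewrite mem_iota => /andP[_ yw].
have /andP[-> qE] := rev_crossings_sound _ _ _ yw qn.
by split=> //; apply/existsP; exists (Ordinal yw).
Qed.

Lemma size_rev_crossingsS n y :
  size (rev_crossings n.+1 y) = (size (rev_crossings n y) +
   sumn [seq size (rev_crossings n z)
    | z <- iota 0 w & bw_step t (lattice_pt n.+1 z) (lattice_pt n.+1 y)])%N.
Proof. by rewrite /= size_cat size_map size_allpairs_dep. Qed.

End Crossings.

(** * The recurrence for width 4 *)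

Definition height_counts (t : bw_type) (n : nat) : seq nat :=
  [seq size (rev_crossings t 4 n y) | y <- iota 0 4].

(* The vertical edges of a column join the heights 0-1 and 2-3, or only 1-2. *)
Definition pairs_outer (t : bw_type) (n : nat) : bool :=
  if t is First then ~~ odd n else odd n.

(** Two joined heights have opposite parity in their column, so the edge can be used both ways and
    each height adds the count of its partner to its own. *)
Lemma height_countsS t n a b c d : height_counts t n = [:: a; b; c; d] ->
  height_counts t n.+1 =
  if pairs_outer t n.+1 then [:: a + b; a + b; c + d; c + d]%N
  else [:: a; b + c; b + c; d]%N.
Proof.
rewrite /height_counts; cbn [map iota] => -[Ea Eb Ec Ed].
rewrite !size_rev_crossingsS /= /bw_step /even_point /odd_point /lattice_pt /=.
rewrite !xpair_eqE.
have -> : (n.+1%:Z == n.+1%:Z + 1) = false by lia.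
rewrite !eqxx /= !oddD /=.
case: t Ea Eb Ec Ed => /= Ea Eb Ec Ed; case: (odd n) => /=; rewrite Ea Eb Ec Ed.
all: by congr [:: _; _; _; _]; lia.
Qed.

Lemma bw_countE t n : bw_count t n.+1 4 = sumn (height_counts t n).
Proof. exact: bw_count_rev_crossings. Qed.

Lemma height_counts0 t : height_counts t 0 = nseq 4 1%N.
Proof. by []. Qed.

Lemma bw_count_base t : bw_count t 1 4 = 4%N /\
  bw_count t 2 4 = (if t is First then 6 else 8)%N.
Proof.
rewrite !bw_countE height_counts0 (height_countsS _ _ _ _ _ _ (height_counts0 t)).
by case: t.
Qed.

Lemma pairs_outerS t n : pairs_outer t n.+1 = ~~ pairs_outer t n.
Proof. by case: t. Qed.

Lemma bw_count_rec t n : bw_count t n.+3 4 = (3 * bw_count t n.+1 4)%N.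
Proof.
rewrite !bw_countE.
have [a [b [c [d E]]]] : exists a b c d, height_counts t n = [:: a; b; c; d].
  by do 4!eexists.
(* With the outer pairs first, the second step yields (a + b, s, s, c + d) with s = a + b + c + d,
   which triples the total for any vector. *)
have [outer|inner] := boolP (pairs_outer t n.+1).
  have := height_countsS _ _ _ _ _ _ E; rewrite outer => /height_countsS ->.
  by rewrite pairs_outerS outer E /=; lia.
(* With the inner pair first, the total becomes 2(a + d) + 4(b + c), so this balance is required.
   Either [n = 0], or column [n] joins the outer pairs. *)
have adbc : (a + d = b + c)%N.
  case: n E inner => [|n] E inner; first by case: E => <- <- <- <-.
  have [a' [b' [c' [d' E']]]] : exists a b c d, height_counts t n = [:: a; b; c; d].
    by do 4!eexists.
  move: E; rewrite (height_countsS _ _ _ _ _ _ E').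
  by move: inner; rewrite pairs_outerS negbK => -> [<- <- <- <-]; lia.
have := height_countsS _ _ _ _ _ _ E; rewrite (negPf inner) => /height_countsS ->.
by rewrite pairs_outerS inner E /=; lia.
Qed.

Theorem mainTheorem4 :
  (bw_series First 4 =1
     fps_div (fps_of_poly (4 *: 'X + 6 *: 'X^2)) (fps_of_poly (1 - 3 *: 'X^2)))
  /\
  (bw_series Second 4 =1
     fps_div (fps_of_poly (4 *: 'X + 8 *: 'X^2)) (fps_of_poly (1 - 3 *: 'X^2))).
Proof.
by split; apply: fps_quot_unique => [|||n]; rewrite /bw_series //=
  ?(bw_count_base _).1 ?(bw_count_base _).2 // bw_count_rec natrM.
Qed.
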